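(* Let $\mathbb{K}$ be an algebraically closed field, let $n\ge 1$, and let $\sigma$ be a regular action of the algebraic $n$-torus $\mathbb{T}_n=(\mathbb{K}^\times)^n$ on the free associative algebra $F_n=\mathbb{K}\langle z_1,\ldots,z_n\rangle$. If $\sigma$ is effective, then it is linearizable.
   Context: An action of $\mathbb{T}_n$ on $F_n$ is a group homomorphism $\sigma:\mathbb{T}_n\to \operatorname{Aut}_{\mathbb{K}} F_n$. It is regular (algebraic) if the images $\sigma(t)(z_i)$ are noncommutative polynomials in $z_1,\dots,z_n$ of degree bounded independently of $t$, whose coefficients are regular functions on $\mathbb{T}_n$. It is effective if $\operatorname{Ker}\sigma=\{1\}$. It is linearizable if there is an automorphism $\beta\in\operatorname{Aut}F_n$ such that, for all $t\in\mathbb{T}_n$, the automorphism $\beta^{-1}\circ\sigma(t)\circ\beta$ is linear (maps each $z_i$ to a $\mathbb{K}$-linear combination of $z_1,\dots,z_n$). *)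

(* Defs.v *)
From HB Require Import structures.
From mathcomp Require Import all_boot all_order all_algebra.
From mathcomp.multinomials Require Export monalg.

Set Implicit Arguments.
Unset Strict Implicit.
Unset Printing Implicit Defensive.

Import GRing.Theory.
Local Open Scope ring_scope.

Record torus (K : fieldType) (n : nat) := Torus {
  torus_val :> {ffun 'I_n -> K};
  torus_valP : [forall i, torus_val i != 0]
}.

Section TorusGroup.
Variables (K : fieldType) (n : nat).

HB.instance Definition _ := [isSub for @torus_val K n].
HB.instance Definition _ := [Choice of torus K n by <:].

Lemma torus_neq0 (t : torus K n) i : t i != 0.
Proof. exact: (forallP (torus_valP t)). Qed.

Fact torus_one_subproof : [forall i, [ffun _ : 'I_n => 1 : K] i != 0].
Proof. by apply/forallP => i; rewrite ffunE oner_neq0. Qed.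
Definition torus_one : torus K n := Torus torus_one_subproof.

Fact torus_mul_subproof (s t : torus K n) :
  [forall i, [ffun j => s j * t j] i != 0].
Proof. by apply/forallP => i; rewrite ffunE mulf_neq0 ?torus_neq0. Qed.
Definition torus_mul (s t : torus K n) : torus K n :=
  Torus (torus_mul_subproof s t).

Fact torus_inv_subproof (t : torus K n) :
  [forall i, [ffun j => (t j)^-1] i != 0].
Proof. by apply/forallP => i; rewrite ffunE invr_neq0 ?torus_neq0. Qed.
Definition torus_inv (t : torus K n) : torus K n :=
  Torus (torus_inv_subproof t).

Fact torus_mulA : associative torus_mul.
Proof. by move=> r s t; apply/val_inj/ffunP => i; rewrite !ffunE mulrA. Qed.

Fact torus_mul1 : left_id torus_one torus_mul.
Proof. by move=> t; apply/val_inj/ffunP => i; rewrite !ffunE mul1r. Qed.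

Fact torus_mulr1 : right_id torus_one torus_mul.
Proof. by move=> t; apply/val_inj/ffunP => i; rewrite !ffunE mulr1. Qed.

Fact torus_mulV : left_inverse torus_one torus_inv torus_mul.
Proof.
by move=> t; apply/val_inj/ffunP => i; rewrite !ffunE mulVf ?torus_neq0.
Qed.

Fact torus_mulrV : right_inverse torus_one torus_inv torus_mul.
Proof.
by move=> t; apply/val_inj/ffunP => i; rewrite !ffunE mulfV ?torus_neq0.
Qed.

HB.instance Definition _ := isGroup.Build (torus K n)
  torus_mulA torus_mul1 torus_mulr1 torus_mulV torus_mulrV.

End TorusGroup.

(* The coordinate ring of the torus is K[t_1^{+-1}, ..., t_n^{+-1}], and a
   Laurent polynomial is given by its list of (coefficient, exponents). *)
Definition regular_fun (K : fieldType) (n : nat) (f : torus K n -> K) : Prop :=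
  exists L : seq (K * {ffun 'I_n -> int}),
    forall t : torus K n,
      f t = \sum_(p <- L) p.1 * \prod_(i < n) (t i) ^ (p.2 i).

(* Monoid algebra of the free monoid of words on 'I_n. *)
Notation freeAlg K n := {malg K[{fmonom 'I_n}]}.

Definition gen (K : fieldType) (n : nat) (i : 'I_n) : freeAlg K n :=
  << fmu i >>.

Definition deg_le (K : fieldType) (n : nat) (d : nat) (g : freeAlg K n) : Prop :=
  forall w : {fmonom 'I_n}, g@_w != 0 -> (fdeg w <= d)%N.

(* The inverse is part of the data only as a function: it is determined by
   the automorphism, and is automatically a morphism of K-algebras. *)
Record algAut (K : fieldType) (n : nat) := AlgAut {
  aut_val :> {lrmorphism freeAlg K n -> freeAlg K n};
  aut_inv : freeAlg K n -> freeAlg K n;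
  aut_valK : cancel aut_val aut_inv;
  aut_invK : cancel aut_inv aut_val
}.

(* Automorphisms are compared as functions, so as not to depend on the
   equality of the proofs they carry. A multiplicative map between groups
   preserves 1 and inverses. *)
Definition is_action (K : fieldType) (n : nat)
    (sigma : torus K n -> algAut K n) : Prop :=
  forall s t : torus K n, sigma (s * t)%g =1 sigma s \o sigma t.

Definition regular_action (K : fieldType) (n : nat)
    (sigma : torus K n -> algAut K n) : Prop :=
  (exists d : nat, forall (t : torus K n) (i : 'I_n),
     deg_le d (sigma t (gen K i)))
  /\ (forall (i : 'I_n) (w : {fmonom 'I_n}),
        regular_fun (fun t => (sigma t (gen K i))@_w)).

Definition effective (K : fieldType) (n : nat)
    (sigma : torus K n -> algAut K n) : Prop :=
  forall t : torus K n, sigma t =1 id -> t = 1%g.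

Definition linear_map (K : fieldType) (n : nat)
    (f : freeAlg K n -> freeAlg K n) : Prop :=
  forall i : 'I_n, exists a : 'I_n -> K,
    f (gen K i) = \sum_(j < n) a j *: gen K j.

Definition linearizable (K : fieldType) (n : nat)
    (sigma : torus K n -> algAut K n) : Prop :=
  exists beta : algAut K n, forall t : torus K n,
    linear_map (aut_inv beta \o sigma t \o beta).

(* Main.v *)
From HB Require Import structures.
Require Import Defs.
From mathcomp Require Import all_boot all_order all_algebra.
From mathcomp Require Import finmap zify ring.
From mathcomp.multinomials Require mpoly.

(* Regularity and independence of characters split [F_n], and its
   abelianization, the polynomial ring [A], into weight vectors of the torus.

   Fixed point: effectiveness forces the weights of [A] to have rank [n], since
   a one-parameter subgroup acting trivially on [A] acts unipotently on [F_n],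
   hence trivially. Counting monomials then shows that the weight [0] part of
   [A] is [K]. As the units of [A] are constant, opposite nonzero weights
   multiply to [0], so the sum of the nonzero weight spaces is an invariant
   maximal ideal. Translate its point [p] to the origin.

   Linearization: the ideal [m] generated by the variables is now invariant, so
   there are weight vectors [f_1, ..., f_n] in [m] whose linear parts form a
   basis. A weight vector lying in [m^k] but not in [m^(k+1)] has for weight a
   sum of [k] of the weights of the [f_i], and these are linearly independent,
   so that [k] is determined by the weight. Hence a weight vector that agrees
   modulo [m^(k+1)] with a polynomial of the same weight in the [f_i] is equal
   to it, and [z_i |-> f_i] is an automorphism. *)

Set Implicit Arguments.
Unset Strict Implicit.
Unset Printing Implicit Defensive.

Import GRing.Theory.
Local Open Scope ring_scope.

(** * Weights of torus actions *)

Section Characters.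
Variables (K : closedFieldType) (n : nat).
Implicit Types (a b : {ffun 'I_n -> int}) (s t : torus K n).

Definition char a t : K := \prod_(i < n) (t i) ^ (a i).

Lemma charMr a s t : char a (s * t)%g = char a s * char a t.
Proof.
by rewrite -big_split; apply: eq_bigr => i _; rewrite ffunE expfzMl.
Qed.

Lemma charD a b t : char (a + b) t = char a t * char b t.
Proof.
rewrite -big_split; apply: eq_bigr => i _.
by rewrite ffunE expfzDr ?torus_neq0.
Qed.

Lemma char0 t : char 0 t = 1.
Proof. by apply: big1 => i _; rewrite ffunE expr0z. Qed.

Lemma char1 a : char a 1%g = 1.
Proof. by apply: big1 => i _; rewrite ffunE exp1rz. Qed.

Lemma exists_expz_neq1 (k : int) :
  k != 0 -> exists2 x : K, x != 0 & x ^ k != 1.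
Proof.
wlog: k / exists m : nat, k = m.+1.
  move=> IH; case: k => [[|m]|m] // _; first exact: (IH m.+1 (ex_intro _ m _)).
  have [x x0 xk] := IH m.+1 (ex_intro _ m erefl) isT; exists x => //.
  by rewrite NegzE -invr_expz invr_eq1.
case=> m -> _.
(* A root [x] of [X^(m+2) - X + 1] satisfies [x (x^(m+1) - 1) = - 1]. *)
pose c (i : nat) : K := if i == 0%N then -1 else if i == 1%N then 1 else 0.
have [x xP] := solve_monicpoly c (n := m.+2) isT.
have {xP} xP : x * (x ^+ m.+1 - 1) = -1.
  move: xP; rewrite !big_ord_recl big1 => [|i _]; last by rewrite mul0r.
  by rewrite /= expr0 mulr1 expr1 mul1r addr0 mulrBr -exprS mulr1 => ->; rewrite addrK.
have: x * (x ^+ m.+1 - 1) != 0 by rewrite xP oppr_eq0 oner_eq0.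
by rewrite mulf_eq0 negb_or subr_eq0 => /andP[]; exists x.
Qed.

(* The junk value at [x = 0] is the unit of the torus. *)
Lemma one_parameter_subproof (x : K) (l : {ffun 'I_n -> int}) :
  [forall i, [ffun j => if x == 0 then 1 : K else x ^ l j] i != 0].
Proof.
apply/forallP => i; rewrite ffunE; case: (eqVneq x 0) => [_|x0]; first exact: oner_neq0.
exact: expfz_neq0.
Qed.
Definition one_parameter x l : torus K n := Torus (one_parameter_subproof x l).

Lemma one_parameterE x l i : x != 0 -> one_parameter x l i = x ^ l i.
Proof. by move=> /negPf x0; rewrite /= ffunE x0. Qed.

Definition pairing (l a : {ffun 'I_n -> int}) : int := \sum_(i < n) l i * a i.

Lemma char_one_parameter x l a :
  x != 0 -> char a (one_parameter x l) = x ^ pairing l a.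
Proof.
move=> x0; rewrite /char /pairing.
elim/big_rec2: _ => [|i y z _ ->]; first by rewrite expr0z.
by rewrite one_parameterE // expfzDr // exprz_exp.
Qed.

Lemma char_separates a b : a != b -> exists t, char a t != char b t.
Proof.
move=> neq_ab; have [i abi] : exists i, a i - b i != 0.
  apply/existsP; apply: contraNT neq_ab => /existsPn h; apply/eqP/ffunP => i.
  by apply/eqP; rewrite -subr_eq0; have := h i; rewrite negbK.
have [x x0 xi] := exists_expz_neq1 abi.
pose t := one_parameter x [ffun j => (j == i)%:R].
have chE c : char c t = x ^ c i.
  rewrite char_one_parameter // /pairing (bigD1 i) //= big1 => [|j /negPf ji].
    by rewrite ffunE eqxx mul1r addr0.
  by rewrite ffunE ji mul0r.
exists t; rewrite !chE; apply: contraNneq xi => xab.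
by rewrite expfzDr // xab -expfzDr // subrr expr0z.
Qed.

(** Artin's argument: translating the relation by [t0] and subtracting [char a t0] times the
    relation removes [a] and multiplies each other [v b] by [char b t0 - char a t0]. Here [t0] is
    chosen to separate [b] from [a]. *)
Lemma char_independent (V : lmodType K) (r : seq {ffun 'I_n -> int})
    (v : {ffun 'I_n -> int} -> V) :
  uniq r -> (forall t, \sum_(a <- r) char a t *: v a = 0) ->
  {in r, forall a, v a = 0}.
Proof.
elim: r v => [//|a r IH] v /= /andP[ar ur] h.
have vr0 : {in r, forall b, v b = 0}.
  move=> b br; have [t0 nt0] : exists t, char b t != char a t.
    by apply: char_separates; apply: contraNneq ar => <-.
  have /IH - /(_ ur) : forall t,
      \sum_(c <- r) char c t *: ((char c t0 - char a t0) *: v c) = 0.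
    move=> t; transitivity (\sum_(c <- a :: r) char c (t * t0)%g *: v c -
        char a t0 *: \sum_(c <- a :: r) char c t *: v c); last first.
      by rewrite !h scaler0 subrr.
    rewrite !big_cons scalerDr opprD addrACA scalerA charMr [char a t * _]mulrC.
    rewrite subrr add0r scaler_sumr -sumrB; apply: eq_bigr => c _.
    by rewrite charMr !scalerA -scalerBl mulrBr [_ * char a t0]mulrC.
  by move=> /(_ b br)/eqP; rewrite scaler_eq0 subr_eq0 (negPf nt0) => /eqP.
move=> b; rewrite inE => /orP[/eqP-> {b}|/vr0 //].
have := h 1%g; rewrite big_cons char1 scale1r big_seq big1 ?addr0 // => b br.
by rewrite vr0 // scaler0.
Qed.

(* A family of vectors indexed by weights is encoded as a list of (weight,
   vector) pairs in which weights may be repeated. *)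
Definition component (V : lmodType K) (L : seq ({ffun 'I_n -> int} * V)) a : V :=
  \sum_(p <- L | p.1 == a) p.2.

Definition support_of (V : lmodType K) (L : seq ({ffun 'I_n -> int} * V)) :=
  undup [seq p.1 | p <- L].

Lemma sum_components (V : lmodType K) (L : seq ({ffun 'I_n -> int} * V))
    (c : {ffun 'I_n -> int} -> K) :
  \sum_(p <- L) c p.1 *: p.2 = \sum_(a <- support_of L) c a *: component L a.
Proof.
under [RHS]eq_bigr do rewrite scaler_sumr.
rewrite (exchange_big_dep xpredT) //= big_seq [RHS]big_seq.
apply: eq_bigr => p pL; rewrite (eq_bigl (pred1 p.1)); last first.
  by move=> a /=; rewrite eq_sym.
by rewrite -big_filter filter_pred1_uniq ?undup_uniq ?big_seq1 ?mem_undup ?map_f.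
Qed.

Lemma component_out (V : lmodType K) (L : seq ({ffun 'I_n -> int} * V)) a :
  a \notin support_of L -> component L a = 0.
Proof.
rewrite mem_undup => aL; rewrite /component big_seq_cond big1 // => p /andP[pL /eqP pa].
by rewrite -pa map_f in aL.
Qed.

Lemma component_eq0 (V : lmodType K) (L : seq ({ffun 'I_n -> int} * V)) :
  (forall t, \sum_(p <- L) char p.1 t *: p.2 = 0) -> forall a, component L a = 0.
Proof.
move=> h a; have [aL|/component_out //] := boolP (a \in support_of L).
apply: (char_independent (undup_uniq [seq p.1 | p <- L])) aL => t.
by rewrite -(sum_components L (char^~ t)).
Qed.

End Characters.

Section Weights.
Variables (K : closedFieldType) (n : nat) (B : lalgType K).
Variable tau : torus K n -> {lrmorphism B -> B}.
Hypotheses (tauM : forall s t u, tau (s * t)%g u = tau s (tau t u))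
           (tau1 : forall u, tau 1%g u = u).
Implicit Types (a b : {ffun 'I_n -> int}) (u v : B).

Definition weight_vector a u := forall t, tau t u = char a t *: u.

Lemma weight0 a : weight_vector a 0.
Proof. by move=> t; rewrite raddf0 scaler0. Qed.

Lemma weightD a u v :
  weight_vector a u -> weight_vector a v -> weight_vector a (u + v).
Proof. by move=> hu hv t; rewrite raddfD /= hu hv scalerDr. Qed.

Lemma weightZ a c u : weight_vector a u -> weight_vector a (c *: u).
Proof. by move=> hu t; rewrite linearZ /= hu !scalerA mulrC. Qed.

Lemma weightN a u : weight_vector a u -> weight_vector a (- u).
Proof. by move=> hu t; rewrite raddfN /= hu scalerN. Qed.

Lemma weight_sum a (I : Type) (r : seq I) (P : pred I) (F : I -> B) :
  (forall i, P i -> weight_vector a (F i)) ->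
  weight_vector a (\sum_(i <- r | P i) F i).
Proof.
move=> h; elim/big_rec: _ => [|i y Pi hy]; first exact: weight0.
by apply: weightD hy; apply: h.
Qed.

(* [B] is not required to be an [algType] because Multinomials declares that
   structure on monoid algebras only for commutative monoids. *)
Hypothesis BscalerAr : forall c u v, c *: (u * v) = u * (c *: v).

Lemma weightM a b u v :
  weight_vector a u -> weight_vector b v -> weight_vector (a + b) (u * v).
Proof.
by move=> hu hv t; rewrite rmorphM /= hu hv charD -scalerAl -BscalerAr scalerA.
Qed.

Lemma weight1 : weight_vector 0 1.
Proof. by move=> t; rewrite rmorph1 char0 scale1r. Qed.

Lemma weightX a u m : weight_vector a u -> weight_vector (a *+ m) (u ^+ m).
Proof.
move=> hu; elim: m => [|m IH]; first exact: weight1.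
by rewrite mulrS exprS; exact: weightM hu IH.
Qed.

Lemma weight_uniq a b u :
  u != 0 -> weight_vector a u -> weight_vector b u -> a = b.
Proof.
move=> u0 ha hb; apply/eqP; apply: contraNT u0 => neq_ab.
have [t nt] := char_separates K neq_ab.
have := ha t; rewrite hb => /eqP; rewrite -subr_eq0 -scalerBl scaler_eq0.
by rewrite subr_eq0 eq_sym (negPf nt).
Qed.

Definition weight_list (L : seq ({ffun 'I_n -> int} * B)) :=
  forall p, p \in L -> weight_vector p.1 p.2.

Lemma tau_weight_list L t : weight_list L ->
  tau t (\sum_(p <- L) p.2) = \sum_(p <- L) char p.1 t *: p.2.
Proof.
move=> hL; rewrite raddf_sum big_seq [RHS]big_seq; apply: eq_bigr => p pL.
exact: hL.
Qed.

Lemma weight_component L a : weight_list L -> weight_vector a (component L a).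
Proof.
move=> hL; rewrite /component big_seq_cond; apply: weight_sum => p.
by move=> /andP[/hL hp /eqP <-].
Qed.

Lemma weight_list_eq0 L :
  weight_list L -> \sum_(p <- L) p.2 = 0 -> forall a, component L a = 0.
Proof.
by move=> hL L0; apply: component_eq0 => t; rewrite -tau_weight_list // L0 raddf0.
Qed.

Definition decomposable u := exists2 L, weight_list L & u = \sum_(p <- L) p.2.

Lemma decomposable_weight a u : weight_vector a u -> decomposable u.
Proof.
move=> hu; exists [:: (a, u)]; last by rewrite big_seq1.
by move=> p; rewrite inE => /eqP->.
Qed.

Lemma decomposableD u v : decomposable u -> decomposable v -> decomposable (u + v).
Proof.
move=> [L hL ->] [M hM ->]; exists (L ++ M); last by rewrite big_cat.
by move=> p; rewrite mem_cat => /orP[/hL|/hM].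
Qed.

Lemma decomposable_sum (I : eqType) (r : seq I) (F : I -> B) :
  (forall i, i \in r -> decomposable (F i)) -> decomposable (\sum_(i <- r) F i).
Proof.
elim: r => [|i r IH] h.
  by rewrite big_nil; apply: decomposable_weight (weight0 0).
rewrite big_cons; apply: decomposableD; first by apply: h; rewrite mem_head.
by apply: IH => j jr; apply: h; rewrite inE jr orbT.
Qed.

Lemma decomposableM u v : decomposable u -> decomposable v -> decomposable (u * v).
Proof.
move=> [L hL ->] [M hM ->]; rewrite mulr_suml; apply: decomposable_sum => p /hL hp.
rewrite mulr_sumr; apply: decomposable_sum => q /hM hq.
exact: decomposable_weight (weightM hp hq).
Qed.

Lemma decomposableZ c u : decomposable u -> decomposable (c *: u).
Proof.
move=> [L hL ->]; rewrite scaler_sumr; apply: decomposable_sum => p /hL hp.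
exact: decomposable_weight (weightZ c hp).
Qed.

(* Comparing the two expansions of [tau (s * t) u] shows that the coefficient
   of [char a] in the orbit map of [u] is a weight vector. *)
Lemma decomposable_orbit u (L : seq ({ffun 'I_n -> int} * B)) :
  (forall t, tau t u = \sum_(p <- L) char p.1 t *: p.2) -> decomposable u.
Proof.
move=> hu.
have hc a : a \in support_of L -> weight_vector a (component L a).
  move=> aL s; apply/eqP; rewrite -subr_eq0; apply/eqP.
  apply: (char_independent (v := fun a => tau s (component L a) - char a s *: component L a)
    (undup_uniq [seq p.1 | p <- L])) (aL) => t.
  have := tauM s t u; rewrite !hu (sum_components L (fun b => char b (s * t)%g)).
  rewrite (sum_components L (fun b => char b t)).
  rewrite raddf_sum /= => /esym/eqP; rewrite -subr_eq0 -sumrB => /eqP h; rewrite -[RHS]h.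
  apply: eq_bigr => b _ /=.
  have -> : tau s (char b t *: component L b) = char b t *: tau s (component L b).
    exact: linearZ.
  by rewrite scalerBr scalerA charMr [char b t * _]mulrC.
exists [seq (a, component L a) | a <- support_of L].
  by move=> p /mapP[a aL ->]; apply: hc.
rewrite -(tau1 u) hu (sum_components L (fun b => char b 1%g)) big_map.
by apply: eq_bigr => a _; rewrite char1 scale1r.
Qed.

End Weights.

(** * The free algebra and its filtration by order *)

Section FreeAlgebraStructure.
Variables (I : choiceType) (R : comRingType).

Fact malg_scalerAr (c : R) (u v : {malg R[{fmonom I}]}) :
  c *: (u * v) = u * (c *: v).
Proof.
apply/malgP => w; rewrite mcoeffZ (mcoeffMl u v w) mulr_sumr.
rewrite (mcoeffMlw w (fsubset_refl _) (msuppZ_le c v)).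
apply: eq_bigr => w1 _; rewrite mulr_sumr; apply: eq_bigr => w2 _.
by rewrite mcoeffZ mulrCA mulrnAr.
Qed.

End FreeAlgebraStructure.

Section Substitution.
Variables (K : fieldType) (n : nat).
Local Notation F := (freeAlg K n).
Implicit Types (u v : F) (w : {fmonom 'I_n}).

Lemma malgUE (c : K) w : << c *g w >> = c *: << w >> :> F.
Proof. by apply/malgP => w'; rewrite mcoeffZ (mcoeffU w c) (mcoeffU w 1) mulrnAr mulr1. Qed.

Lemma word_expansion u : u = \sum_(w <- msupp u) u@_w *: << w >>.
Proof. by rewrite {1}[u]monalgE; apply: eq_bigr => w _; rewrite malgUE. Qed.

Lemma malgUM w1 w2 : << w1 >> * << w2 >> = << mmul w1 w2 >> :> F.
Proof. by rewrite malgM_def fgmulUU mulr1. Qed.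

Lemma word_prod w : << w >> = \prod_(i <- w) gen K i.
Proof.
case: w => s /=; elim: s => [|i s IH]; first by rewrite big_nil -fmoneE.
rewrite big_cons -IH /gen malgUM; congr << _ >>.
by apply/eqP; rewrite fmP fmM fmU.
Qed.

Lemma freeAlg_ind (P : F -> Prop) :
  P 1 -> (forall c u, P u -> P (c *: u)) ->
  (forall u v, P u -> P v -> P (u + v)) ->
  (forall i u, P u -> P (gen K i * u)) -> forall u, P u.
Proof.
move=> P1 PZ PD PM u; rewrite [u]word_expansion.
elim/big_ind: _ => [||w _]; first by rewrite -[0](scale0r 1); apply: PZ.
  exact: PD.
apply: PZ; rewrite word_prod; elim: {w}(w : seq _) => [|i s IH].
  by rewrite big_nil.
by rewrite big_cons; apply: PM.
Qed.

Lemma lrmorphism_ext (B : lalgType K) (f g : {lrmorphism F -> B}) :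
  (forall i, f (gen K i) = g (gen K i)) -> f =1 g.
Proof.
move=> fg; elim/freeAlg_ind => [|c u IH|u v IHu IHv|i u IH].
- by rewrite !rmorph1.
- by rewrite !linearZ /= IH.
- by rewrite !raddfD /= IHu IHv.
- by rewrite !rmorphM /= fg IH.
Qed.

Section Universal.
Variables (B : lalgType K) (h : 'I_n -> B).
Hypothesis BscalerAr : forall (c : K) (x y : B), c *: (x * y) = x * (c *: y).

Definition eval_word (w : {fmonom 'I_n}) : B := \prod_(i <- w) h i.

Fact eval_word_mmorphism : mmorphism eval_word.
Proof. by split=> [w1 w2|]; rewrite /eval_word ?fmM ?big_cat ?fm1 ?big_nil. Qed.

HB.instance Definition _ :=
  monalg.isMultiplicative.Build {fmonom 'I_n} B eval_word eval_word_mmorphism.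

Lemma exists_subst : {f : {lrmorphism F -> B} | forall i, f (gen K i) = h i}.
Proof.
pose f u : B := mmap (in_alg B) eval_word u.
have f_linear : linear f.
  by move=> c u v; rewrite /f mmapD mmapZ -scalerAl mul1r.
(* The extension to [F] is multiplicative once coefficients commute with values of words; scalars
   are central in [B] by [BscalerAr]. *)
have f_comm (u : F) w w' : GRing.comm (in_alg B u@_w) (eval_word w').
  by rewrite /GRing.comm -scalerAl -BscalerAr mul1r mulr1.
have [fM f1] := commr_mmap_is_multiplicative f_comm.
pose fL := GRing.isLinear.Build K F B *:%R f f_linear.
pose fR := GRing.isMonoidMorphism.Build F B f (f1, fM).
pose fLR : {lrmorphism F -> B} := HB.pack f fL fR.
exists fLR => i; rewrite /fLR /= /f mmapU /= scale1r mul1r /eval_word.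
by rewrite fmU big_seq1.
Qed.

End Universal.

Definition subst (h : 'I_n -> F) : {lrmorphism F -> F} :=
  sval (exists_subst h (@malg_scalerAr _ K)).

Lemma subst_gen h i : subst h (gen K i) = h i.
Proof. exact: (svalP (exists_subst h (@malg_scalerAr _ K))). Qed.

End Substitution.

Section Order.
Variables (K : fieldType) (n : nat).
Local Notation F := (freeAlg K n).
Implicit Types (u v : F) (w : {fmonom 'I_n}).

(** Membership in the [k]-th power of the two-sided ideal generated by the variables. *)
Definition order_ge k u := all (fun w => k <= fdeg w)%N (msupp u).

Lemma order_geP k u :
  reflect (forall w, (fdeg w < k)%N -> u@_w = 0) (order_ge k u).
Proof.
apply: (iffP allP) => h w; last first.
  by rewrite -mcoeff_neq0 leqNgt; apply: contra => /h/eqP.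
move=> wk; apply/eqP; rewrite mcoeff_eq0; apply: contraL wk => /h.
by rewrite -leqNgt.
Qed.

Lemma order_ge_leq k l u : (k <= l)%N -> order_ge l u -> order_ge k u.
Proof.
by move=> kl /order_geP h; apply/order_geP => w wk; apply/h/(leq_trans wk).
Qed.

Lemma order_ge0 u : order_ge 0 u.
Proof. exact/order_geP. Qed.

Lemma order_ge_zero k : order_ge k 0.
Proof. by apply/order_geP => w _; rewrite mcoeff0. Qed.

Lemma order_geD k u v : order_ge k u -> order_ge k v -> order_ge k (u + v).
Proof.
move=> /order_geP hu /order_geP hv; apply/order_geP => w wk.
by rewrite mcoeffD hu ?hv ?addr0.
Qed.

Lemma order_geZ k c u : order_ge k u -> order_ge k (c *: u).
Proof.
by move=> /order_geP hu; apply/order_geP => w wk; rewrite mcoeffZ hu ?mulr0.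
Qed.

Lemma order_geN k u : order_ge k (- u) = order_ge k u.
Proof.
by apply/idP/idP => /(order_geZ (-1)); rewrite scaleN1r ?opprK.
Qed.

Lemma order_geB k u v : order_ge k u -> order_ge k v -> order_ge k (u - v).
Proof. by move=> hu hv; rewrite order_geD ?order_geN. Qed.

Lemma order_ge_sum k (T : Type) (r : seq T) (P : pred T) (f : T -> F) :
  (forall x, P x -> order_ge k (f x)) -> order_ge k (\sum_(x <- r | P x) f x).
Proof.
move=> h; elim/big_rec: _ => [|x u Px hu]; first exact: order_ge_zero.
by rewrite order_geD ?h.
Qed.

Lemma order_geM k l u v :
  order_ge k u -> order_ge l v -> order_ge (k + l) (u * v).
Proof.
move=> /allP hu /allP hv; apply/allP => w /msuppM_le[w1 [w2 [/hu h1 /hv h2 ->]]].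
by rewrite fdegM leq_add.
Qed.

Lemma order_ge_gen i : order_ge 1 (gen K i).
Proof.
apply/order_geP => w; rewrite ltnS leqn0 fdeg_eq0 => /eqP->.
by rewrite mcoeffU1 fm1_eq1.
Qed.

Lemma order_ge_prod_gen s : order_ge (size s) (\prod_(i <- s) gen K i).
Proof.
elim: s => [|i s IH]; first exact: order_ge0.
by rewrite big_cons -[size _]/(1 + size s)%N; apply: order_geM (order_ge_gen i) IH.
Qed.

Lemma exists_order u : u != 0 -> exists2 k, order_ge k u & ~~ order_ge k.+1 u.
Proof.
move=> u0; have [k hk] : exists k, ~~ order_ge k u.
  have [w wu] : exists w, u@_w != 0.
    have /fset0Pn[w] : msupp u != fset0 by rewrite msupp_eq0.
    by rewrite -mcoeff_neq0; exists w.
  by exists (fdeg w).+1; apply: contra wu => /order_geP/(_ w (ltnSn _))->.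
elim: k hk => [|k IH] hk; first by rewrite order_ge0 in hk.
by have [hk'|/IH//] := boolP (order_ge k u); exists k.
Qed.

(** Here [f] is merely linear, so that the bound also applies to [u |-> f u - u] for a morphism
    [f]. *)
Lemma order_ge_expand k u (f : F -> F) (l : nat) :
  linear f -> order_ge k u ->
  (forall s : seq 'I_n, (k <= size s)%N ->
     order_ge l (f (\prod_(i <- s) gen K i))) ->
  order_ge l (f u).
Proof.
move=> flin /allP hu h.
pose f' : {linear F -> F} := HB.pack f (GRing.isLinear.Build _ _ _ _ f flin).
rewrite -[f u]/(f' u) [u in f' u]word_expansion linear_sum big_seq.
apply: order_ge_sum => w /hu kw; rewrite linearZ order_geZ //.
by rewrite word_prod; apply: h.
Qed.

Section Morphism.
Variable f : {lrmorphism F -> F}.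

Lemma order_ge_lrmorphism k u :
  (forall i, order_ge 1 (f (gen K i))) -> order_ge k u -> order_ge k (f u).
Proof.
move=> hf /order_ge_expand; apply; first exact: linearP.
move=> s ks; apply: (order_ge_leq ks) => {ks}.
elim: s => [|i s IH]; first exact: order_ge0.
by rewrite big_cons rmorphM -[size _]/(1 + size s)%N; apply: order_geM (hf i) IH.
Qed.

Hypothesis f_unipotent : forall i, order_ge 2 (f (gen K i) - gen K i).

Lemma unipotent_order1 i : order_ge 1 (f (gen K i)).
Proof.
rewrite -(subrK (gen K i) (f _)) order_geD ?order_ge_gen //.
exact: order_ge_leq (f_unipotent i).
Qed.

Lemma unipotent_order k u : order_ge k u -> order_ge k.+1 (f u - u).
Proof.
move=> /(order_ge_expand (f := fun u => f u - u)); apply.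
  by move=> c x y; rewrite linearP scalerBr opprD addrACA.
move=> s ks; apply: (@order_ge_leq _ (size s).+1) => // {ks}.
elim: s => [|i s IH].
  by rewrite !big_nil rmorph1 subrr order_ge_zero.
rewrite !big_cons rmorphM /=; set p := \prod_(_ <- _) _ in IH *.
(* Both terms gain one order: the first through [f (gen K i) - gen K i], the second through the
   induction hypothesis. *)
have -> : f (gen K i) * f p - gen K i * p =
    (f (gen K i) - gen K i) * p + f (gen K i) * (f p - p).
  by rewrite mulrBl mulrBr [RHS]addrC addrA subrK.
have hp : order_ge (size s) p by apply: order_ge_prod_gen.
have -> : (size (i :: s)).+1 = (2 + size s)%N by [].
apply: order_geD; first exact: order_geM (f_unipotent i) hp.
by rewrite -[(2 + _)%N]/(1 + (size s).+1)%N; apply: order_geM (unipotent_order1 i) IH.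
Qed.

(** A kernel element of exact order [k] would equal, up to sign, [f u - u], whose order is at least
    [k + 1]. *)
Lemma unipotent_inj u : f u = 0 -> u = 0.
Proof.
move=> fu; apply/eqP; apply: contraT => /exists_order[k /unipotent_order].
by rewrite fu sub0r order_geN => ->.
Qed.

End Morphism.
End Order.

(** * Integer vectors and polynomials *)

Section IntegerVectors.
Variable n : nat.
Implicit Types l : {ffun 'I_n -> int}.

(** The [a i] span rational [n]-space. This dual form, with [l] integral, is the one that
    one-parameter subgroups can test. *)
Definition spanning (a : 'I_n -> {ffun 'I_n -> int}) :=
  forall l, (forall i, pairing l (a i) = 0) -> l = 0.

(** The square matrix [M] has nonzero determinant, since a kernel vector of its transpose is
    orthogonal to all [a i]. A nontrivial relation would be a kernel vector of [M] itself. *)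
Lemma spanning_independent a (m : 'I_n -> int) :
  spanning a -> \sum_i a i *~ m i = 0 -> forall i, m i = 0.
Proof.
move=> sa ma0 i; pose M := \matrix_(i, j) a i j.
have : \det M != 0.
  rewrite -det_tr; apply/det0P => -[v v0 vM]; case/negP: v0.
  have /ffunP v0 : [ffun j => v 0 j] = 0.
    apply: sa => k; have /rowP/(_ k) := vM; rewrite !mxE => <-.
    by apply: eq_bigr => j _; rewrite !mxE ffunE.
  by apply/eqP/rowP => j; have := v0 j; rewrite !ffunE !mxE.
apply: contraNeq => mi; apply/det0P; exists (\row_i m i).
  by apply: contraNneq mi => /rowP/(_ i); rewrite !mxE => ->.
have h j : \sum_k (a k *~ m k) j = 0 by rewrite -sum_ffunE ma0 ffunE.
apply/rowP => j; rewrite !mxE -[RHS](h j).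
apply: eq_bigr => k _; rewrite !mxE.
have -> : (a k *~ m k) j = a k j *~ m k.
  by case: (m k) => p; rewrite /intmul ?ffunE ffunMnE.
by rewrite -mulrzr mulrC intz.
Qed.

Lemma exists_spanning (L : seq {ffun 'I_n -> int}) :
  (forall l, {in L, forall a, pairing l a = 0} -> l = 0) ->
  exists2 a, spanning a & forall i, a i \in L.
Proof.
move=> hL; pose W : 'M[rat]_(size L, n) := \matrix_(k, j) (L`_k j)%:~R.
have Wfull : row_full W.
  rewrite -cokermx_eq0; apply: contraT => /eqP coker_neq0; case: coker_neq0.
  apply/matrixP => i j; rewrite [RHS]mxE; set v := fun k => cokermx W k j.
  have vW (k : 'I_(size L)) : \sum_i (L`_k i)%:~R * v i = 0.
    transitivity ((W *m cokermx W) k j); last by rewrite mulmx_coker mxE.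
    by rewrite mxE; apply: eq_bigr => p _; rewrite [W k p]mxE.
  (* [D] clears the denominators of the cokernel column [v], so that [l] is the integer vector
     [D v], orthogonal to all of [L]. *)
  pose D := \prod_k denq (v k).
  pose l := [ffun i => numq (v i) * \prod_(k | k != i) denq (v k)].
  have lE k : (l k)%:~R = v k * D%:~R.
    rewrite ffunE; have -> : D = denq (v k) * \prod_(j | j != k) denq (v j).
      exact: bigD1.
    by rewrite !intrM numqE mulrA.
  have /ffunP/(_ i) : l = 0.
    apply: hL => a aL; apply/eqP; rewrite -(intr_eq0 rat) rmorph_sum /=.
    rewrite -index_mem in aL; have := vW (Ordinal aL).
    rewrite /= nth_index -?index_mem // => va.
    apply/eqP; rewrite -[RHS](mul0r D%:~R) -[X in _ = X * _]va mulr_suml; apply: eq_bigr => k _.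
    by rewrite intrM lE mulrAC [_ * v k]mulrC.
  move/(congr1 (fun x : int => x%:~R : rat)); rewrite lE ffunE => /eqP.
  have D0 : D != 0 by apply/prodf_neq0 => k _; apply: denq_neq0.
  by rewrite mulf_eq0 intr_eq0 (negPf D0) orbF => /eqP.
pose f := fullrankfun Wfull.
exists (fun i => L`_(f i)) => [l hl|i]; last exact: mem_nth.
have Uf : rowsub f W \in unitmx by rewrite -row_full_unit fullrowsub_full.
have : rowsub f W *m (\col_i (l i)%:~R) = 0.
  apply/colP => i; rewrite !mxE.
  transitivity ((pairing l L`_(f i))%:~R : rat); last by rewrite hl.
  rewrite rmorph_sum /=.
  by apply: eq_bigr => j _; rewrite !mxE intrM mulrC.
move/(congr1 (mulmx (invmx (rowsub f W)))); rewrite mulKmx // mulmx0.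
move=> /colP l0; apply/ffunP => i; have /eqP := l0 i.
by rewrite !mxE intr_eq0 ffunE => /eqP.
Qed.

End IntegerVectors.

Section Polynomials.
Import mpoly.
Variables (K : closedFieldType) (n : nat).
Local Notation A := (mpoly.mpoly n K).
Implicit Types f g : A.

(** The coefficient matrix has one column for each of the [M ^ n] monomials with all exponents below
    [M], hence more rows than columns and a nonzero left kernel. *)
Lemma linear_dependence (J : finType) (P : J -> A) (M : nat) :
  (forall j, msize (P j) <= M)%N -> (M ^ n < #|J|)%N ->
  exists c : J -> K, (exists j, c j != 0) /\ \sum_j c j *: P j = 0.
Proof.
move=> PM MJ; pose T := {ffun 'I_n -> 'I_M}.
pose X := \matrix_(i < #|J|, k < #|T|)
  (P (enum_val i))@_[multinom (enum_val k x : nat) | x < n].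
pose v := nz_row (kermx X).
have v0 : v != 0.
  rewrite nz_row_eq0 kermx_eq0 /row_free neq_ltn; apply/orP; left.
  by apply: leq_ltn_trans (rank_leq_col X) _; rewrite card_ffun !card_ord.
have vX : v *m X = 0 by apply/sub_kermxP; apply: nz_row_sub.
exists (fun j => v 0 (enum_rank j)); split.
  have [i vi] := rV0Pn _ v0.
  by exists (enum_val i); rewrite enum_valK.
apply/mpolyP => m; rewrite mcoeff0 raddf_sum /=.
have [mM|] := boolP [forall i, m i < M]%N; last first.
  case/forallPn => i; rewrite -leqNgt => Mm; apply: big1 => j _.
  rewrite mcoeffZ memN_msupp_eq0 ?mulr0 //; apply/msize_mdeg_ge.
  apply: leq_trans (PM j) (leq_trans Mm _).
  by rewrite mdegE (bigD1 i) //= leq_addr.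
pose t : T := [ffun i => Ordinal (forallP mM i)].
transitivity ((v *m X) 0 (enum_rank t)); last by rewrite vX mxE.
rewrite mxE.
rewrite [RHS](reindex (@enum_rank J)) /=; last exact: onW_bij (enum_rank_bij J).
apply: eq_bigr => j _; rewrite mcoeffZ [X _ _]mxE !enum_rankK; congr (_ * _@_ _).
by apply/mnmP => i; rewrite mnmE ffunE.
Qed.

Lemma msizeM_leS d e f g :
  (msize f <= d.+1)%N -> (msize g <= e.+1)%N -> (msize (f * g) <= (d + e).+1)%N.
Proof.
move=> fd ge; have [->|f0] := eqVneq f 0; first by rewrite mul0r msize0.
have [->|g0] := eqVneq g 0; first by rewrite mulr0 msize0.
by rewrite msizeM //; move: (msize f) (msize g) fd ge => a b; lia.
Qed.

Lemma msizeX_leS d f m : (msize f <= d.+1)%N -> (msize (f ^+ m) <= (m * d).+1)%N.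
Proof.
move=> fd; elim: m => [|m IH]; first by rewrite expr0 msize1.
by rewrite exprS mulSn; apply: msizeM_leS.
Qed.

Lemma algebraic_dependence (f : 'I_n -> A) g :
  exists N (c : {ffun 'I_n -> 'I_N} * 'I_N -> K),
    (exists p, c p != 0) /\
    \sum_p c p *: (\prod_i f i ^+ p.1 i * g ^+ p.2) = 0.
Proof.
pose d := (msize g + \sum_i msize (f i))%N.
have fd i : (msize (f i) <= d.+1)%N by rewrite /d (bigD1 i) //=; lia.
have gd : (msize g <= d.+1)%N by rewrite /d; lia.
(* The [N ^ (n + 1)] products have degree at most [N * D], so the box of their monomials has at most
   [(N * D + 1) ^ n <= N ^ n * (D + 1) ^ n] elements. Any [N] above [(D + 1) ^ n] forces a
   dependence. *)
pose D := (n * d + d)%N; pose N := ((D.+1) ^ n).+1; exists N.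
apply: (linear_dependence (M := (N * D).+1)) => [[m j]|] /=.
  have hprod : (msize (\prod_i f i ^+ m i) <= (\sum_(i < n) N * d).+1)%N.
    elim/big_rec2: _ => [|i y z _ IH]; first by rewrite msize1.
    apply: msizeM_leS IH; apply: leq_trans (msizeX_leS _ (fd i)) _.
    by rewrite ltnS leq_mul2r ltnW ?orbT.
  have hg : (msize (g ^+ j) <= (N * d).+1)%N.
    apply: leq_trans (msizeX_leS _ gd) _.
    by rewrite ltnS leq_mul2r ltnW ?orbT.
  apply: leq_trans (msizeM_leS hprod hg) _.
  by rewrite sum_nat_const card_ord ltnS /D; nia.
rewrite card_prod card_ffun !card_ord.
apply: (@leq_ltn_trans ((N * D.+1) ^ n)).
  have ND : ((N * D).+1 <= N * D.+1)%N by rewrite mulnS -add1n leq_add2r.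
  by elim: n => // k IH; rewrite !expnS leq_mul.
by rewrite expnMn ltn_pmul2l ?expn_gt0.
Qed.

End Polynomials.

(** * Fixed points on the abelianization *)

Section Abelianization.
Import mpoly.
Variables (K : fieldType) (n : nat).
Local Notation A := (mpoly.mpoly n K).
Local Notation F := (freeAlg K n).

Definition abelianize : {lrmorphism F -> A} :=
  sval (exists_subst (fun i => 'X_i : A) (@scalerAr K A)).

Lemma abelianize_gen i : abelianize (gen K i) = 'X_i.
Proof. exact: (svalP (exists_subst (fun i => 'X_i : A) (@scalerAr K A))). Qed.

Lemma abelianize_gen_shift i (c : K) : abelianize (gen K i - c%:A) = 'X_i - c%:A.
Proof. by rewrite raddfB /= linearZ /= rmorph1 abelianize_gen. Qed.

(** Both sides are algebra morphisms to [K] sending the [i]-th variable to [p i]. Vanishing at [p]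
    thus becomes absence of a constant term after translation. *)
Lemma subst_translation_const (p : 'I_n -> K) u :
  monalg.mcoeff mone (subst (fun i => gen K i + (p i)%:A) u) = (abelianize u).@[p].
Proof.
elim/freeAlg_ind: u => [|c u IH|u v IHu IHv|i u IH].
- by rewrite !rmorph1.
- by rewrite !linearZ /= IH.
- by rewrite !raddfD /= IHu IHv.
rewrite !rmorphM /= IH subst_gen abelianize_gen mevalXU; congr (_ * _).
rewrite monalg.mcoeffD monalg.mcoeffZ mcoeffU1 fm1_eq1 add0r.
by rewrite monalg.mcoeff1 eqxx mulr1.
Qed.

Lemma abelianize_surj f : exists u, abelianize u = f.
Proof.
elim/mpolyind: f => [|c m f _ _ [u <-]]; first by exists 0; rewrite raddf0.
exists (c *: \prod_i gen K i ^+ m i + u).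
rewrite raddfD /= linearZ /= rmorph_prod mpolyXE_id; congr (_ *: _ + _).
by apply: eq_bigr => i _; rewrite rmorphXn /= abelianize_gen.
Qed.

(** A word with at most one letter is determined by its exponent vector, so abelianization preserves
    its coefficient. *)
Lemma abelianize_ker u : abelianize u = 0 -> order_ge 2 u.
Proof.
move=> u0; apply/order_geP => w w2.
pose e (s : seq 'I_n) : 'X_{1..n} := (\sum_(i <- s) U_(i))%MM.
have inj_e (s : seq 'I_n) : e s = e w -> s = w.
  have deg_e r : mdeg (e r) = size r.
    rewrite mdeg_sum; under eq_bigr do rewrite mdeg1.
    by rewrite sum1_size.
  move=> es; have := congr1 (@mdeg n) es; rewrite !deg_e.
  move: es w2; rewrite fdegE; case: (w : seq _) => [|i [|? ?]] //=.
    by case: s.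
  case: s => [|j [|? ?]] //; rewrite /e !big_seq1 => /eqP + _ _.
  by rewrite eq_mnm1 => /eqP ->.
have uE : abelianize u = \sum_(w <- monalg.msupp u) monalg.mcoeff w u *: 'X_[e w].
  rewrite [u in LHS]word_expansion linear_sum; apply: eq_bigr => w' _.
  rewrite linearZ /=; congr (_ *: _); rewrite word_prod rmorph_prod -mprodXE.
  by apply: eq_bigr => i _; exact: abelianize_gen.
have := congr1 (mcoeff (e w)) u0; rewrite mcoeff0 uE raddf_sum /=.
have [wu|] := boolP (w \in monalg.msupp u); last by move/monalg.mcoeff_outdom.
rewrite (bigD1_seq w wu (fset_uniq _)) /= big1 ?addr0 => [|w' ww'].
  by rewrite mcoeffZ mcoeffX eqxx mulr1.
rewrite mcoeffZ mcoeffX; case: eqP => [/inj_e ww|]; last by rewrite mulr0.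
by case/eqP: ww'; apply/eqP; rewrite fmP ww.
Qed.

End Abelianization.
Arguments abelianize {K n}.

Section FixedPoint.
Import mpoly.
Variables (K : closedFieldType) (n : nat).
Local Notation A := (mpoly.mpoly n K).
Variable tau : torus K n -> {lrmorphism A -> A}.
Variables (a : 'I_n -> {ffun 'I_n -> int}) (f : 'I_n -> A).
Hypotheses (a_spanning : spanning a) (f_neq0 : forall i, f i != 0).
Hypothesis f_weight : forall i, weight_vector tau (a i) (f i).

(* Otherwise the [f i] and [g] would be [n + 1] algebraically independent
   polynomials in [n] variables. *)
Lemma weight0_const (g : A) : weight_vector tau 0 g -> exists c, g = c%:A.
Proof.
move=> g0; have [N [c [[[m j] cmj]]]] := algebraic_dependence f g.
pose wt (m : {ffun 'I_n -> 'I_N}) := \sum_i a i *+ m i.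
pose term p := c p *: (\prod_i f i ^+ p.1 i * g ^+ p.2).
(* Independence of the [a i] gives distinct monomials in the [f i] distinct weights, so each weight
   component of the relation is one monomial times a polynomial in [g]. *)
have wt_inj : injective wt.
  move=> m1 m2 /eqP; rewrite -subr_eq0 -sumrB => /eqP m12.
  apply/ffunP => i; apply/val_inj => /=.
  have := spanning_independent (m := fun i => (m1 i)%:Z - (m2 i)%:Z) a_spanning.
  move=> /(_ _ i) h; apply/eqP; rewrite -eqz_nat -subr_eq0; apply/eqP/h.
  by rewrite -[RHS]m12; apply: eq_bigr => k _; rewrite mulrzBr -!pmulrn.
have term_weight p : weight_vector tau (wt p.1) (term p).
  apply: weightZ; rewrite -[wt _]addr0; apply: (weightM (@scalerAr K A)); last first.
    by rewrite -(mul0rn _ p.2); apply: (weightX (@scalerAr K A)).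
  rewrite /wt; elim/big_rec2: _ => [|i x y _ IH]; first exact: weight1.
  by apply: (weightM (@scalerAr K A)) IH; apply: (weightX (@scalerAr K A)).
pose L := [seq (wt p.1, term p) | p <- enum {: {ffun 'I_n -> 'I_N} * 'I_N}].
move=> c0; have hL : weight_list tau L by move=> q /mapP[p _ ->]; apply: term_weight.
have L0 : \sum_(q <- L) q.2 = 0 by rewrite big_map big_enum.
have {hL L0} := weight_list_eq0 hL L0 (wt m).
rewrite /component big_map big_enum_cond /= => cm.
have {cm} : \prod_i f i ^+ m i * \sum_j c (m, j) *: g ^+ j = 0.
  rewrite -[RHS]cm mulr_sumr (reindex_onto (fun j => (m, j)) snd) /=; last first.
    by case=> m' j' /= /eqP/wt_inj ->.
  rewrite [RHS](eq_bigl predT) => [|j']; last by rewrite !eqxx.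
  by apply: eq_bigr => j' _; rewrite /term /= scalerAr.
have fm0 : \prod_i f i ^+ m i != 0 by apply/prodf_neq0 => i _; apply: expf_neq0.
move/eqP; rewrite mulf_eq0 (negPf fm0) => /eqP cg0.
(* [g] is a root of the nonzero polynomial [q], which splits over [K]; as [A] is a domain, some
   factor [g - z] vanishes. *)
pose q : {poly K} := \sum_(j < N) c (m, j) *: 'X^j.
have q0 : q != 0.
  apply: contraNneq cmj => /(congr1 (fun q : {poly K} => q`_j)).
  rewrite coef0 coef_sum (bigD1 j) //= big1 ?addr0 => [|k kj].
    by rewrite coefZ coefXn eqxx mulr1 => ->.
  by rewrite coefZ coefXn (inj_eq val_inj) eq_sym (negPf kj) mulr0.
have : horner_alg g q = 0.
  rewrite -[RHS]cg0 linear_sum; apply: eq_bigr => k _.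
  by rewrite linearZ /= mulr_algl rmorphXn /= horner_algX.
have [r ->] := closed_field_poly_normal q.
rewrite linearZ /= mulr_algl rmorph_prod => /eqP; rewrite scaler_eq0 lead_coef_eq0.
rewrite (negPf q0) /= prodf_seq_eq0 => /hasP[z _ /=].
by rewrite rmorphB /= horner_algX horner_algC subr_eq0 => /eqP ->; exists z.
Qed.

(** The product is constant by [weight0_const]. If it were nonzero, [u] would be a unit, hence a
    constant, hence of weight 0. *)
Lemma weightM_eq0 b1 b2 u v :
  weight_vector tau b1 u -> weight_vector tau b2 v ->
  b1 != 0 -> b1 + b2 = 0 -> u * v = 0.
Proof.
move=> hu hv b0 b12; apply/eqP; apply: contraNT b0 => uv0.
have [c uvc] : exists c, u * v = c%:A.
  by apply: weight0_const; rewrite -b12; apply: (weightM (@scalerAr K A)).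
have c0 : c != 0 by apply: contraNneq uv0 => c0; rewrite uvc c0 scale0r.
have /andP[/eqP uC _] : u \in @mpoly_unit n K.
  apply: (@mpoly_intro_unit n K u (c^-1 *: v)).
  by rewrite -scalerAl mulrC uvc scalerA mulVf // scale1r.
have u0 : u != 0 by apply: contraNneq uv0 => ->; rewrite mul0r.
apply/eqP/(weight_uniq u0 hu); rewrite uC -alg_mpolyC.
exact/weightZ/weight1.
Qed.

(** These polynomials will form the maximal ideal of the fixed point. *)
Definition moving (g : A) := exists2 L, weight_list tau L &
  {in L, forall q, q.1 != 0} /\ g = \sum_(q <- L) q.2.

Lemma moving_sum (I : eqType) (r : seq I) (h : I -> A) :
  (forall i, i \in r -> moving (h i)) -> moving (\sum_(i <- r) h i).
Proof.
elim: r => [|i r IH] hr; first by exists [::] => //; rewrite !big_nil.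
rewrite big_cons; have [L hL [L0 Li]] := hr i (mem_head i r).
have [M hM [M0 ->]] : moving (\sum_(j <- r) h j).
  by apply: IH => j jr; apply: hr; rewrite inE jr orbT.
exists (L ++ M); last split.
- by move=> q; rewrite mem_cat => /orP[/hL|/hM].
- by move=> q; rewrite mem_cat => /orP[/L0|/M0].
- by rewrite big_cat -Li.
Qed.

Lemma moving_weight b u : b != 0 -> weight_vector tau b u -> moving u.
Proof.
move=> b0 hu; exists [:: (b, u)]; last split; last by rewrite big_seq1.
  by move=> q; rewrite inE => /eqP->.
by move=> q; rewrite inE => /eqP->.
Qed.

Lemma moving0 : moving 0.
Proof. by exists [::] => //; split=> //; rewrite big_nil. Qed.

Lemma movingD g1 g2 : moving g1 -> moving g2 -> moving (g1 + g2).
Proof.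
move=> h1 h2; have : moving (\sum_(g <- [:: g1; g2]) g).
  by apply: moving_sum => i; rewrite !inE => /orP[]/eqP->.
by rewrite big_cons big_seq1.
Qed.

Lemma moving_const c : moving (c%:A) -> c = 0.
Proof.
(* Adding the opposite constant in weight 0 gives a zero sum whose component of weight 0 is that
   entry alone. *)
case=> L hL [L0 cL]; pose L' := (0, - c%:A) :: L.
have hL' : weight_list tau L'.
  move=> q; rewrite inE => /orP[/eqP->|/hL //] /=.
  exact/weightN/weightZ/weight1.
have := weight_list_eq0 hL' _ 0; rewrite big_cons -cL addNr => /(_ erefl).
rewrite /component big_cons eqxx big_seq_cond big_pred0 => [|q]; last first.
  by apply/negP => /andP[/L0/negPf->].
by rewrite addr0 => /eqP; rewrite oppr_eq0 scaler_eq0 oner_eq0 orbF => /eqP.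
Qed.

Hypothesis tau_decomposable : forall g, decomposable tau g.

Lemma movingM g h : moving g -> moving (g * h).
Proof.
case=> L hL [L0 ->]; have [M hM ->] := tau_decomposable h.
rewrite mulr_suml; apply: moving_sum => q qL.
rewrite mulr_sumr; apply: moving_sum => r rM.
have [qr|qr] := eqVneq (q.1 + r.1) 0; last first.
  exact: moving_weight qr (weightM (@scalerAr K A) (hL q qL) (hM r rM)).
rewrite (weightM_eq0 (hL q qL) (hM r rM) (L0 q qL) qr); exact: moving0.
Qed.

Lemma movingZ c g : moving g -> moving (c *: g).
Proof. by rewrite -mulr_algl mulrC; apply: movingM. Qed.

Lemma moving_tau t g : moving g -> moving (tau t g).
Proof.
case=> L hL [L0 ->]; rewrite tau_weight_list //; apply: moving_sum => q qL.
exact: moving_weight (L0 q qL) (weightZ _ (hL q qL)).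
Qed.

Lemma exists_fixed_point :
  exists p : 'I_n -> K, forall t i, (tau t ('X_i - (p i)%:A)).@[p] = 0.
Proof.
(* The coordinate [p i] is the weight 0 component of ['X_i]. *)
have : forall i, exists c : K, moving ('X_i - c%:A).
  move=> i; have [L hL XL] := tau_decomposable 'X_i.
  have [c Lc] := weight0_const (weight_component 0 hL).
  exists c; rewrite -Lc XL (bigID (fun q => q.1 == 0)) /= [X in X - _]addrC addrK.
  rewrite -big_filter; exists [seq q <- L | q.1 != 0] => [q|].
    by rewrite mem_filter => /andP[_ /hL].
  by split=> // q; rewrite mem_filter => /andP[].
move/fin_all_exists => [p hp]; exists p => t i.
(* The moving polynomials form an ideal that contains every ['X_j - p j]. *)
have moving_eval g : moving (g - (g.@[p])%:A).
  have [u <-] := abelianize_surj g.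
  elim/freeAlg_ind: u => [|c u IH|u v IHu IHv|j u IH].
  - by rewrite rmorph1 meval1 scale1r subrr; apply: moving0.
  - rewrite linearZ /= mevalZ -scalerA -scalerBr; exact: movingZ IH.
  - rewrite raddfD /= mevalD scalerDl opprD addrACA; exact: movingD IHu IHv.
  - rewrite rmorphM /= mevalM abelianize_gen mevalXU.
    have -> : 'X_j * abelianize u - (p j * (abelianize u).@[p])%:A =
      ('X_j - (p j)%:A) * abelianize u + (abelianize u - ((abelianize u).@[p])%:A) * (p j)%:A.
      rewrite -scalerA -mulr_algl.
      move: ((abelianize u).@[p])%:A => E; move: (p j)%:A => P; ring.
    exact: movingD (movingM _ (hp j)) (movingM _ IH).
(* Both [g] and its difference with its value at [p] are moving, so this value is a moving constant,
   that is, 0. *)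
have := moving_eval (tau t ('X_i - (p i)%:A)); set g := tau t _ => hg.
have : moving g by apply: moving_tau.
case=> L hL [L0 gL]; apply: moving_const.
have -> : (g.@[p])%:A = g + - 1 *: (g - (g.@[p])%:A).
  by rewrite scaleN1r opprB addrC subrK.
apply: movingD; first by exists L.
exact: movingZ.
Qed.

End FixedPoint.

(** * Generators that are weight vectors *)

Section GradedGenerators.
Variables (K : closedFieldType) (n : nat).
Local Notation F := (freeAlg K n).
Variable sigma : torus K n -> {lrmorphism F -> F}.
Hypothesis sigma_decomposable : forall u, decomposable sigma u.
Hypothesis sigma_order1 : forall t i, order_ge 1 (sigma t (gen K i)).

(** Since [sigma t] preserves order, a word [w] shorter than [k] has coefficient 0 in the image of
    the sum for every [t]. Independence of characters then kills the coefficient of [w] in each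
    component. *)
Lemma component_order k (L : seq ({ffun 'I_n -> int} * F)) a :
  weight_list sigma L -> order_ge k (\sum_(q <- L) q.2) ->
  order_ge k (component L a).
Proof.
move=> hL Lk; apply/order_geP => w wk.
pose L' : seq ({ffun 'I_n -> int} * K^o) := [seq (q.1, q.2@_w) | q <- L].
have : component L' a = 0.
  apply: component_eq0 => t; rewrite big_map /=.
  transitivity ((sigma t (\sum_(q <- L) q.2))@_w).
    rewrite tau_weight_list // raddf_sum /=; apply: eq_bigr => q _.
    by rewrite mcoeffZ.
  have /order_geP := order_ge_lrmorphism (sigma_order1 t) Lk.
  exact.
by rewrite /component big_map raddf_sum.
Qed.

Lemma exists_graded_coordinates :
  exists (f : 'I_n -> F) (m : 'I_n -> {ffun 'I_n -> int}) (M : 'M[K]_n),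
    [/\ forall i, weight_vector sigma (m i) (f i), forall i, order_ge 1 (f i),
        M \in unitmx & forall i j, (f i)@_(fmu j) = M i j].
Proof.
have : forall i, exists H : seq ({ffun 'I_n -> int} * F),
    [/\ weight_list sigma H, forall q, q \in H -> order_ge 1 q.2
      & gen K i = \sum_(q <- H) q.2].
  move=> i; have [L hL iL] := sigma_decomposable (gen K i).
  exists [seq (a, component L a) | a <- support_of L]; split.
  - by move=> q /mapP[a _ ->]; apply: weight_component.
  - move=> q /mapP[a _ ->]; apply: component_order => //.
    by rewrite -iL order_ge_gen.
  - rewrite big_map iL -[LHS]scale1r scaler_sumr.
    rewrite [LHS](sum_components L (fun=> 1)).
    by apply: eq_bigr => a _; apply: scale1r.
move/fin_all_exists => [H hH].
(* [G] collects the weight components of all generators. Their linear parts add up to the unit rows,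
   hence span, and [n] independent ones are selected. *)
pose G := flatten [seq H i | i <- enum 'I_n].
have GP q : q \in G -> exists i, q \in H i.
  by move=> /flattenP[s /mapP[i _ ->] qi]; exists i.
pose lin (u : F) := \row_j u@_(fmu j).
pose M := \matrix_(k < size G) lin (nth (0, 0) G k).2.
have Mfull : row_full M.
  rewrite -sub1mx; apply/row_subP => i.
  have -> : row i 1%:M = \sum_(q <- H i) lin q.2.
    apply/rowP => j; have [_ _ /(congr1 (mcoeff (fmu j)))] := hH i.
    rewrite raddf_sum /= mcoeffU1 => ij; rewrite !mxE summxE.
    under eq_bigr do rewrite mxE.
    by rewrite -ij (inj_eq (_ : injective (@fmu _))) // => x y; rewrite !fmuE => -[].
  rewrite big_seq; apply: summx_sub => q qH.
  have qG : q \in G by apply/flattenP; exists (H i) => //; apply: map_f; rewrite mem_enum.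
  have qlt : (index q G < size G)%N by rewrite index_mem.
  suff -> : lin q.2 = row (Ordinal qlt) M by apply: row_sub.
  by rewrite rowK /= nth_index.
pose e := fullrankfun Mfull.
have eG i : nth (0, 0) G (e i) \in G by apply: mem_nth.
exists (fun i => (nth (0, 0) G (e i)).2), (fun i => (nth (0, 0) G (e i)).1), (rowsub e M).
split=> [i|i||i j].
- by have [k kH] := GP _ (eG i); have [h _ _] := hH k; apply: h.
- by have [k kH] := GP _ (eG i); have [_ h _] := hH k; apply: h.
- by rewrite -row_full_unit fullrowsub_full.
- by rewrite !mxE.
Qed.

Section Generators.
Variables (f : 'I_n -> F) (m : 'I_n -> {ffun 'I_n -> int}) (M : 'M[K]_n).
Hypotheses (f_weight : forall i, weight_vector sigma (m i) (f i))
           (f_order : forall i, order_ge 1 (f i))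
           (M_unit : M \in unitmx)
           (f_linear : forall i j, (f i)@_(fmu j) = M i j).

Definition linear_subst (N : 'M[K]_n) : {lrmorphism F -> F} :=
  subst (fun i => \sum_j N i j *: gen K j).

Lemma linear_subst_gen N i : linear_subst N (gen K i) = \sum_j N i j *: gen K j.
Proof. exact: subst_gen. Qed.

Lemma linear_subst_comp N1 N2 u :
  linear_subst N1 (linear_subst N2 u) = linear_subst (N2 *m N1) u.
Proof.
pose g : {lrmorphism F -> F} := linear_subst N1 \o linear_subst N2.
have := @lrmorphism_ext _ _ _ g (linear_subst (N2 *m N1)).
apply=> i; rewrite /g /= !linear_subst_gen linear_sum /=.
under eq_bigr do rewrite linearZ /= linear_subst_gen scaler_sumr.
rewrite exchange_big; apply: eq_bigr => j _.
by rewrite mxE scaler_suml; apply: eq_bigr => k _; rewrite scalerA.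
Qed.

Lemma linear_subst1 u : linear_subst 1%:M u = u.
Proof.
have := @lrmorphism_ext _ _ _ (linear_subst 1%:M) (idfun : {lrmorphism F -> F}).
apply=> i /=; rewrite linear_subst_gen (bigD1 i) //= big1 => [|j ji].
  by rewrite mxE eqxx scale1r addr0.
by rewrite mxE eq_sym (negPf ji) scale0r.
Qed.

Lemma linear_subst_order N k u : order_ge k u -> order_ge k (linear_subst N u).
Proof.
apply: order_ge_lrmorphism => i; rewrite linear_subst_gen.
by apply: order_ge_sum => j _; rewrite order_geZ ?order_ge_gen.
Qed.

(** The linear parts of the [f i] form [M], which the linear change of variables by its inverse
    cancels. *)
Lemma subst_unipotent i :
  order_ge 2 (subst f (linear_subst (invmx M) (gen K i)) - gen K i).
Proof.
rewrite linear_subst_gen linear_sum.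
under eq_bigr do rewrite linearZ /= subst_gen.
have f1 j : (f j)@_(mone : {fmonom 'I_n}) = 0.
  by have /order_geP := f_order j; apply; rewrite fdeg1.
apply/order_geP => w; rewrite mcoeffB raddf_sum /=.
have [w0 _|w0] := eqVneq w (mone : {fmonom 'I_n}).
  rewrite w0 mcoeffU1 fm1_eq1 subr0 big1 // => j _.
  by rewrite mcoeffZ f1 mulr0.
move=> w2; have [k ->] : exists k, w = fmu k.
  case: w w0 w2 => -[|k [|? ?]] // w0 _; first by rewrite -fmoneE eqxx in w0.
  by exists k; rewrite fmuE.
have -> : (gen K i)@_(fmu k) = (1%:M : 'M[K]_n) i k.
  rewrite mcoeffU1 mxE (inj_eq (_ : injective (@fmu _))) //.
  by move=> x y; rewrite !fmuE => -[].
rewrite -(mulVmx M_unit) mxE; apply/eqP; rewrite subr_eq0; apply/eqP.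
by apply: eq_bigr => j _; rewrite mcoeffZ f_linear.
Qed.

Definition word_weight (s : seq 'I_n) := \sum_(i <- s) m i.

Lemma subst_word_weight (w : {fmonom 'I_n}) :
  weight_vector sigma (word_weight w) (subst f << w >>).
Proof.
rewrite word_prod rmorph_prod /word_weight.
elim/big_rec2: _ => [|i a u _ IH]; first exact: weight1.
by apply: (weightM (@malg_scalerAr _ K)) IH; rewrite /= subst_gen.
Qed.

(* Degree by degree approximation: the linear change of variables turns
   [subst f] into a unipotent map, and only the words of weight [a] in the
   resulting preimage matter. *)
Lemma approximation a k u : weight_vector sigma a u -> order_ge k u ->
  exists v, [/\ order_ge k.+1 (subst f v - u), weight_vector sigma a (subst f v)
    & ~~ order_ge k.+1 u -> exists2 s, size s = k & word_weight s = a].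
Proof.
move=> hu ku; pose v0 := linear_subst (invmx M) u.
have kv0 : order_ge k v0 by apply: linear_subst_order.
pose wt (w : {fmonom 'I_n}) := word_weight w.
pose term (w : {fmonom 'I_n}) := v0@_w *: subst f << w >>.
have term_weight w : weight_vector sigma (wt w) (term w).
  exact/weightZ/subst_word_weight.
(* With [- u] listed in weight [a], the total is [subst f v0 - u], of order above [k], and its
   component of weight [a] compares [u] with the words of weight [a] only. *)
pose L := (a, - u) :: [seq (wt w, term w) | w <- msupp v0].
have hL : weight_list sigma L.
  move=> q; rewrite inE => /orP[/eqP->|/mapP[w _ ->]]; first exact: weightN.
  exact: term_weight.
have LE : \sum_(q <- L) q.2 = subst f v0 - u.
  rewrite big_cons big_map addrC [v0 in RHS]word_expansion linear_sum.
  by congr (_ + _); apply: eq_bigr => w _; rewrite linearZ.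
pose g : {lrmorphism F -> F} := subst f \o linear_subst (invmx M).
have : order_ge k.+1 (component L a).
  apply: component_order => //; rewrite LE.
  exact: (unipotent_order (f := g) subst_unipotent).
have -> : component L a =
    \sum_(w <- msupp v0 | wt w == a) term w - u.
  by rewrite /component big_cons eqxx big_map addrC.
set v := \sum_(w <- msupp v0 | wt w == a) v0@_w *: << w >>.
have vE : subst f v = \sum_(w <- msupp v0 | wt w == a) term w.
  by rewrite /v linear_sum; apply: eq_bigr => w _; rewrite linearZ.
move=> kv; exists v; split; first by rewrite vE.
  by rewrite vE; apply: weight_sum => w /eqP <-; apply: term_weight.
move=> nku.
have [/hasP[w _ /andP[/eqP wk /eqP wa]]|/hasPn nw] := boolP
    (has (fun w => (fdeg w == k) && (wt w == a)) (msupp v0)).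
  by exists (w : seq _).
(* Without a word of length [k] and weight [a], only words longer than [k] contribute to [S], so [u]
   would have order above [k]. *)
case/negP: nku; rewrite -order_geN.
set S := \sum_(_ <- _ | _) _ in kv.
have -> : - u = (S - u) - S by rewrite addrAC subrr sub0r.
apply: order_geB => //; rewrite /S big_seq_cond; apply: order_ge_sum => w.
case/andP=> wv /eqP wa; apply: order_geZ.
have kw : (k < fdeg w)%N.
  have := nw w wv; rewrite wa eqxx andbT ltn_neqAle eq_sym => ->.
  by have /allP := kv0; apply.
apply: (order_ge_leq kw); apply: order_ge_lrmorphism => [i|].
  by rewrite subst_gen.
by rewrite word_prod; apply: order_ge_prod_gen.
Qed.

Lemma weight_word a u : weight_vector sigma a u -> u != 0 ->
  exists s, word_weight s = a.
Proof.
move=> hu /exists_order[k ku nku].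
have [v [_ _ /(_ nku) [s _ sa]]] := approximation hu ku.
by exists s.
Qed.

Hypothesis m_spanning : spanning m.

(** The weight of a word is the combination of the independent [m i] with its letter counts as
    coefficients, so it determines these counts. *)
Lemma size_word_weight s1 s2 :
  word_weight s1 = word_weight s2 -> size s1 = size s2.
Proof.
have wtE s : word_weight s = \sum_i m i *+ count_mem i s.
  elim: s => [|j s IH]; rewrite /word_weight ?big_nil ?big_cons.
    by rewrite big1.
  rewrite -/(word_weight s) IH; under [RHS]eq_bigr do rewrite mulrnDr.
  rewrite big_split /=; congr (_ + _).
  by rewrite (bigD1 j) //= eqxx big1 ?addr0 // => i /negPf ij; rewrite eq_sym ij.
have szE (s : seq 'I_n) : size s = (\sum_i count_mem i s)%N.
  elim: s => [|j s IH]; first by rewrite big1.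
  have j1 : (\sum_(i < n) (j == i) = 1)%N.
    by rewrite (bigD1 j) //= eqxx big1 // => i /negPf ij; rewrite eq_sym ij.
  by rewrite /= IH big_split /= j1.
rewrite !wtE => /eqP; rewrite -subr_eq0 -sumrB => /eqP m0.
rewrite !szE; apply: eq_bigr => i _; apply/eqP; rewrite -eqz_nat -subr_eq0.
apply/eqP; have := spanning_independent
  (m := fun i => (count_mem i s1)%:Z - (count_mem i s2)%:Z) m_spanning.
by apply; rewrite -[RHS]m0; apply: eq_bigr => k _; rewrite mulrzBr -!pmulrn.
Qed.

Lemma subst_surj u : exists v, subst f v = u.
Proof.
have [L hL ->] := sigma_decomposable u.
elim: L hL => [|[a w] L IH] hL; first by exists 0; rewrite big_nil raddf0.
rewrite big_cons /=; have [v2 <-] : exists v, subst f v = \sum_(q <- L) q.2.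
  by apply: IH => q qL; apply: hL; rewrite inE qL orbT.
have hw : weight_vector sigma a w by apply: (hL (a, w)); rewrite mem_head.
suff [v1 <-] : exists v, subst f v = w by exists (v1 + v2); rewrite raddfD.
have [->|w0] := eqVneq w 0; first by exists 0; rewrite raddf0.
have [k kw nkw] := exists_order w0.
have [v [kv hv /(_ nkw) [s sk sa]]] := approximation hw kw.
(* The approximation is exact: a nonzero remainder would have weight [a] and order above [k], while
   its order and [k] are both lengths of words of weight [a], hence equal. *)
exists v; apply/eqP; rewrite -subr_eq0; apply: contraT => r0.
have hr : weight_vector sigma a (subst f v - w) by apply/weightD/weightN.
have [k' kr nkr] := exists_order r0.
have [_ [_ _ /(_ nkr) [s' sk' sa']]] := approximation hr kr.
have kk' : k = k' by rewrite -sk -sk'; apply: size_word_weight; rewrite sa.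
by rewrite -kk' kv in nkr.
Qed.

Lemma subst_inj : injective (subst f).
Proof.
apply: raddf_inj => v v0.
pose g : {lrmorphism F -> F} := subst f \o linear_subst (invmx M).
have vE : v = linear_subst (invmx M) (linear_subst M v).
  by rewrite linear_subst_comp mulmxV // linear_subst1.
have Mv0 : linear_subst M v = 0.
  by apply: (unipotent_inj (f := g) subst_unipotent); rewrite /g /= -vE.
by rewrite vE Mv0 raddf0.
Qed.

Lemma exists_subst_aut : exists gamma : algAut K n, gamma =1 subst f.
Proof.
have surj u : exists v, subst f v == u by have [v /eqP] := subst_surj u; exists v.
pose g u := xchoose (surj u).
have fgK : cancel g (subst f) by move=> u; apply/eqP/(xchooseP (surj u)).
have gfK : cancel (subst f) g by move=> u; apply: subst_inj; rewrite fgK.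
by exists (AlgAut gfK fgK).
Qed.

End Generators.

Lemma graded_generators (a : 'I_n -> {ffun 'I_n -> int}) (u : 'I_n -> F) :
  spanning a -> (forall i, weight_vector sigma (a i) (u i)) ->
  (forall i, u i != 0) ->
  exists (gamma : algAut K n) (m : 'I_n -> {ffun 'I_n -> int}),
    forall i, weight_vector sigma (m i) (gamma (gen K i)).
Proof.
move=> sa hu u0.
have [f [m [M [fw fo Mu fl]]]] := exists_graded_coordinates.
(* Each [a i] is the weight of a word, so a vector orthogonal to all [m j] is orthogonal to all
   [a i]. *)
have sm : spanning m.
  move=> l lm; apply: sa => i.
  have [s <-] := weight_word fw fo Mu fl (hu i) (u0 i).
  rewrite /word_weight /pairing.
  under eq_bigr do rewrite sum_ffunE mulr_sumr.
  by rewrite exchange_big big1 // => j _; apply: lm.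
have [gamma gE] := exists_subst_aut fw fo Mu fl sm.
by exists gamma, m => i; rewrite gE subst_gen.
Qed.

End GradedGenerators.

(** * The action *)

Section Action.
Variables (K : closedFieldType) (n : nat) (sigma : torus K n -> algAut K n).
Local Notation F := (freeAlg K n).
Local Notation A := (mpoly.mpoly n K).
Hypotheses (sigma_action : is_action sigma) (sigma_regular : regular_action sigma).

Lemma action1 u : sigma 1%g u = u.
Proof.
apply: (can_inj (aut_valK (sigma 1%g))).
by have /= <- := sigma_action 1%g 1%g u; rewrite mulg1.
Qed.

Lemma action_decomposable u : decomposable sigma u.
Proof.
elim/freeAlg_ind: u => [|c u|u v|i u].
- exact: decomposable_weight (weight1 _).
- exact: decomposableZ.
- exact: decomposableD.
apply: (decomposableM (@malg_scalerAr _ K)).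
have [[d deg_d] reg] := sigma_regular.
(* Words of length at most [d] form a finite type and [d] does not depend on [t], so one finite list
   describes the orbit map of a generator. *)
pose word (b : d.-bseq 'I_n) : {fmonom 'I_n} := FMonom b.
have := fin_all_exists (fun b => reg i (word b)) => -[L hL].
pose M := flatten [seq [seq (p.2, p.1 *: (<< word b >> : F)) | p <- L b]
                  | b <- enum {: d.-bseq 'I_n}].
apply: (@decomposable_orbit _ _ _ sigma _ action1 _ M) => [|t].
  by move=> s t v; have /= := sigma_action s t v.
rewrite /M big_flatten big_map big_enum /=.
under eq_bigr => b _.
  rewrite big_map /=.
  under eq_bigr do rewrite scalerA mulrC.
  rewrite -scaler_suml -[X in X *: _]hL.
  over.
apply/malgP => w; rewrite raddf_sum /=.
have [wd|wd] := leqP (fdeg w) d; last first.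
  rewrite big1 => [|b _].
    by apply: contraTeq wd => /deg_d; rewrite -leqNgt.
  rewrite mcoeffZ mcoeffU1; case: eqP => [bw|]; last by rewrite mulr0.
  by have := size_bseq b; rewrite leqNgt -[size _]/(fdeg (word b)) bw wd.
rewrite (bigD1 (Bseq wd)) //= big1 ?addr0 => [|b bw].
  by rewrite mcoeffZ mcoeffU1 /word /= fmK eqxx mulr1.
rewrite mcoeffZ mcoeffU1; case: eqP => [E|]; last by rewrite mulr0.
by case/eqP: bw; apply/val_inj; rewrite /= -E.
Qed.

Import mpoly.

Definition abelian_action t : {lrmorphism A -> A} :=
  mpoly.comp_mpoly [tuple abelianize (sigma t (gen K i)) | i < n].

Lemma abelianize_action t u :
  abelianize (sigma t u) = abelian_action t (abelianize u).
Proof.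
pose f : {lrmorphism F -> A} := abelianize \o sigma t.
pose g : {lrmorphism F -> A} := abelian_action t \o abelianize.
have := @lrmorphism_ext _ _ _ f g; apply=> i; rewrite /f /g /= abelianize_gen.
by rewrite mpoly.comp_mpolyXU -tnth_nth tnth_mktuple.
Qed.

Lemma abelianize_weight a u :
  weight_vector sigma a u -> weight_vector abelian_action a (abelianize u).
Proof. by move=> hu t; rewrite -abelianize_action hu linearZ. Qed.

Lemma abelian_action_decomposable g : decomposable abelian_action g.
Proof.
have [u <-] := abelianize_surj g; have [L hL ->] := action_decomposable u.
rewrite raddf_sum; apply: decomposable_sum => q qL.
exact: decomposable_weight (abelianize_weight (hL q qL)).
Qed.

(* On each graded piece of the filtration by order, [sigma t] acts trivially,
   while it acts on weight vectors by scalars. *)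
Lemma trivial_of_abelian_trivial t :
  (forall i, abelianize (sigma t (gen K i)) = abelianize (gen K i)) ->
  sigma t =1 id.
Proof.
move=> ht u; have [L hL ->] := action_decomposable u.
rewrite [LHS](tau_weight_list t hL) big_seq [RHS]big_seq; apply: eq_bigr => q qL.
have [->|q0] := eqVneq q.2 0; first by rewrite scaler0.
suff /eqP -> : char q.1 t == 1 by rewrite scale1r.
apply: contraT => cn1; have [k kq nkq] := exists_order q0.
have unip i : order_ge 2 (sigma t (gen K i) - gen K i).
  by apply: abelianize_ker; rewrite raddfB /= ht subrr.
have := unipotent_order (f := sigma t) unip kq.
rewrite (hL q qL) -[X in _ - X]scale1r -scalerBl => /(order_geZ (char q.1 t - 1)^-1).
by rewrite scalerA mulVf ?subr_eq0 // scale1r (negPf nkq).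
Qed.

Hypothesis sigma_effective : effective sigma.

(** If [l] is orthogonal to the weights in [W], then each [one_parameter x l] acts trivially on [A],
    hence on [F]. Effectiveness gives [x ^ l i = 1] for all nonzero [x], so [l = 0]. *)
Lemma exists_spanning_weights :
  exists (a : 'I_n -> {ffun 'I_n -> int}) (u : 'I_n -> F),
    [/\ spanning a, forall i, weight_vector sigma (a i) (u i)
      & forall i, abelianize (u i) != 0].
Proof.
have := fin_all_exists2 (fun i => action_decomposable (gen K i)) => -[L hL LE].
(* Components killed by [abelianize] are discarded, so every weight kept is a weight of [A]. *)
pose W := flatten [seq [seq q.1 | q <- L i & abelianize q.2 != 0] | i <- enum 'I_n].
have [l lW|a sa aW] := @exists_spanning n W.
  have lx (x : K) : x != 0 -> forall i, x ^ l i = 1.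
    move=> x0 i; rewrite -(one_parameterE _ _ x0) (@sigma_effective (one_parameter x l)).
      exact: ffunE.
    apply: trivial_of_abelian_trivial => j.
    rewrite LE (tau_weight_list (one_parameter x l) (hL j)) !linear_sum.
    rewrite big_seq [RHS]big_seq; apply: eq_bigr => q qL; rewrite linearZ /=.
    have [->|q0] := eqVneq (abelianize q.2) 0; first by rewrite scaler0.
    rewrite char_one_parameter // lW ?expr0z ?scale1r //.
    apply/flattenP; exists [seq q.1 | q <- L j & abelianize q.2 != 0].
      by apply/mapP; exists j; rewrite ?mem_enum.
    by apply/mapP; exists q; rewrite ?mem_filter ?q0.
  apply/ffunP => i; rewrite ffunE; apply/eqP; apply: contraT => li.
  have [x x0 xl] := exists_expz_neq1 K li.
  by rewrite lx ?eqxx in xl.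
have : forall i, exists2 u, weight_vector sigma (a i) u & abelianize u != 0.
  move=> i; have /flattenP[s /mapP[j _ ->] /mapP[q]] := aW i.
  rewrite mem_filter => /andP[q0 qL] ->; exists q.2 => //; exact: hL qL.
by move/fin_all_exists2 => [u hu u0]; exists a, u.
Qed.

End Action.

Theorem theorem1p3p5 (K : closedFieldType) (n : nat) (hn : (1 <= n)%N)
    (sigma : torus K n -> algAut K n) :
  is_action sigma -> regular_action sigma ->
  effective sigma -> linearizable sigma.
Proof.
move=> act reg eff.
have [a [u [sa ua u0]]] := exists_spanning_weights act reg eff.
have dec := action_decomposable act reg.
have [p hp] := exists_fixed_point sa u0 (fun i => abelianize_weight (ua i))
  (abelian_action_decomposable act reg).
pose T := subst (fun i => gen K i - (p i)%:A).
pose T' := subst (fun i => gen K i + (p i)%:A).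
have TK : cancel T T'.
  pose f : {lrmorphism freeAlg K n -> freeAlg K n} := T' \o T.
  have := @lrmorphism_ext _ _ _ f (idfun : {lrmorphism _ -> _}).
  apply=> i; rewrite /f /= /T subst_gen raddfB /= linearZ /= rmorph1 /T' /= subst_gen.
  by rewrite addrK.
have T'K : cancel T' T.
  pose f : {lrmorphism freeAlg K n -> freeAlg K n} := T \o T'.
  have := @lrmorphism_ext _ _ _ f (idfun : {lrmorphism _ -> _}).
  apply=> i; rewrite /f /= /T' subst_gen raddfD /= linearZ /= rmorph1 /T /= subst_gen.
  by rewrite subrK.
(* This is the action in coordinates centred at the fixed point [p]; it creates no constant
   terms. *)
pose s t : {lrmorphism freeAlg K n -> freeAlg K n} := T' \o (sigma t \o T).
have weight_s b v : weight_vector sigma b v -> weight_vector s b (T' v).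
  by move=> hv t; rewrite /s /= T'K hv linearZ.
have s_dec v : decomposable s v.
  have [L hL Tv] := dec (T v); rewrite -(TK v) Tv raddf_sum.
  by apply: decomposable_sum => q /hL/weight_s; apply: decomposable_weight.
have s_order t i : order_ge 1 (s t (gen K i)).
  apply/order_geP => w; rewrite ltnS leqn0 fdeg_eq0 => /eqP->.
  rewrite /s /= subst_translation_const abelianize_action /T subst_gen.
  by rewrite abelianize_gen_shift; apply: hp.
have T'u0 i : T' (u i) != 0.
  rewrite -(raddf0 T') (can_eq T'K); apply: contraNneq (u0 i) => ->.
  by rewrite raddf0.
have [gamma [m hm]] :=
  graded_generators s_dec s_order sa (fun i => weight_s _ _ (ua i)) T'u0.
pose b : {lrmorphism freeAlg K n -> freeAlg K n} := T \o gamma.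
have bK : cancel b (aut_inv gamma \o T').
  by move=> v; rewrite /b /= TK aut_valK.
have b'K : cancel (aut_inv gamma \o T') b.
  by move=> v; rewrite /b /= aut_invK T'K.
(* In the new coordinates the action is diagonal, with the characters of weights [m i] as
   eigenvalues. *)
exists (AlgAut bK b'K) => t i; exists (fun j => char (m i) t *+ (j == i)).
rewrite (bigD1 i) //= eqxx mulr1n big1 ?addr0 => [|j /negPf ->]; last first.
  by rewrite mulr0n scale0r.
have := hm i t; rewrite /s /= => ->.
by rewrite -linearZ aut_valK.
Qed.
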